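(* Let $G$ be a countably infinite group with identity $e$ such that for each $g\in G\setminus\{e\}$ the set $\{x\in G:x^2=g\}$ is finite. Then for each natural number $n$ there exist subsets $X_0,X_1,\dots,X_{n-1}$ of $G$ such that $\Delta(X_i)=X_{i+1}$ for $0\leqslant i<n-1$, $\Delta(X_{n-1})=X_0$, and $X_i\cap X_j=\{e\}$ for all $0\leqslant i<j<n$.
   Context: For $X\subseteq G$, $\Delta(X)=\{g\in G:|gX\cap X|=\infty\}$. *)

(* Defs.v *)
From mathcomp Require Import all_boot.
From mathcomp Require Import all_classical.

Set Implicit Arguments.
Unset Strict Implicit.
Unset Printing Implicit Defensive.

Local Open Scope classical_set_scope.
Local Open Scope group_scope.

Definition ltranslate (G : groupType) (g : G) (X : set G) : set G :=
  [set g * x | x in X].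

Definition combinatorial_derivation (G : groupType) (X : set G) : set G :=
  [set g | infinite_set (ltranslate g X `&` X)].

(* Main.v *)
Require Import Defs.
From mathcomp Require Import all_boot.
From mathcomp Require Import all_classical.

(** The sets X_i are built simultaneously, in stages, from {1}. At a stage that
serves an index i and some g already put in X_(i+1), the elements x, gx and
their inverses are added to X_i, so that g is once more a quotient of two
elements of X_i. Each pair (i, g) is served infinitely often, whence
X_(i+1) is contained in Delta(X_i). For the converse, x is chosen generic: no
new element, and no quotient involving one, falls in the finite set of group
elements enumerated so far, except for the quotients 1, g and g^-1, which
already lie in X_(i+1). Finiteness of the sets of square roots excludes all but
finitely many x as far as x^2, gx^2, xgx and (gx)^2 are concerned. The remaining
quotient x^-1 g x equals g if x is taken in the centralizer of g; if that
centralizer is finite, x^-1 g x takes each value finitely often. *)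

Local Open Scope classical_set_scope.
Local Open Scope group_scope.

Lemma finite_preimage_fibers (T U : Type) (P : set T) (B : set U) (f : T -> U) :
    finite_set B -> (forall b, B b -> finite_set (P `&` f @^-1` [set b])) ->
  finite_set (P `&` f @^-1` B).
Proof.
move=> Bfin /(bigcup_finite Bfin); apply: sub_finite_set => x [Px Bfx].
by exists (f x).
Qed.

(** Each nonempty fibre of [x |-> g ^ x] is a right coset of the centralizer of [g]. So [P] is the
    whole group if the centralizer is finite, and the centralizer itself otherwise. *)
Lemma infinite_set_conj_fibers (G : groupType) (g : G) :
  infinite_set [set: G] ->
  exists2 P : set G, infinite_set P &
    forall b, b <> g -> finite_set (P `&` [set x | g ^ x = b]).
Proof.
move=> Ginf; have [Cfin|Cinf] := pselect (finite_set [set x : G | g ^ x = g]).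
  exists [set: G] => // b _.
  have [->|/set0P[x0 [_ /= x0b]]] :=
    eqVneq ([set: G] `&` [set x | g ^ x = b]) set0; first exact: finite_set0.
  apply: sub_finite_set (finite_image (fun c => c * x0) Cfin) => x [_ /= xb].
  by exists (x * x0^-1); rewrite /= ?mulgVK // conjgM xb -x0b conjgK.
exists [set x | g ^ x = g] => // b bg.
by apply: sub_finite_set (finite_set0 G) => x [/= -> /esym].
Qed.

(** Inverses are included to keep every X_j symmetric, as any Delta(X) is. *)
Definition pair_closure (G : groupType) (g x : G) : set G :=
  [set x; g * x; x^-1; (g * x)^-1].

Lemma exists_generic_pair (G : groupType) (g : G) (B : set G) :
    infinite_set [set: G] ->
    (forall h : G, h <> 1 -> finite_set [set x : G | x ^+ 2 = h]) ->
    finite_set B ->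
  exists x, (forall u, pair_closure G g x u -> ~ B u) /\
    (forall u v, pair_closure G g x u -> pair_closure G g x v ->
       B (u * v^-1) -> [set 1; g; g^-1] (u * v^-1)).
Proof.
move=> Ginf sqrt_fin Bfin.
have [P Pinf Pconj] := infinite_set_conj_fibers G g Ginf.
pose C := B `|` [set w^-1 | w in B].
have Cfin : finite_set C by rewrite finite_setU; split=> //; exact: finite_image.
have CV w : C w -> C w^-1.
  by case=> [Bw|[v Bv <-]]; [right; exists w | left; rewrite invgK].
pose E := C `\` [set 1; g; g^-1].
have Efin : finite_set E by exact: finite_setD.
have EV w : E w^-1 -> E w.
  move=> [Cw Kw]; split; first by rewrite -[w]invgK; exact: CV.
  move=> Kw'; apply: Kw; move: Kw' => [[]|] /= ->.
  - by left; left; rewrite invg1.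
  - by right.
  - by left; right; rewrite invgK.
have EN w : E w -> [/\ w <> 1, w <> g & w <> g^-1].
  by move=> [_ Kw]; split=> wE; apply: Kw; rewrite wE; [left; left|left; right|right].
have inj_fin (f : G -> G) : injective f -> finite_set (P `&` f @^-1` C).
  move=> finj; apply: finite_setIr; apply: finite_preimage => // x y _ _.
  exact: finj.
(* Up to inversion, the sixteen quotients of two elements of [pair_closure G g x] are 1, [g] and the
   five words tested against [E]. As [E] is symmetric, one word of each inverse pair suffices. *)
pose bad := (P `&` id @^-1` C) `|` (P `&` (fun x => g * x) @^-1` C)
  `|` (P `&` (fun x => x * x) @^-1` E) `|` (P `&` (fun x => x * g * x) @^-1` E)
  `|` (P `&` (fun x => g * x * x) @^-1` E)
  `|` (P `&` (fun x => g * x * g * x) @^-1` E)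
  `|` (P `&` (fun x => g ^ x) @^-1` E).
have badfin : finite_set bad.
  have sq b : b <> 1 -> finite_set [set x : G | x * x = b] by exact: sqrt_fin.
  have sq' b : b <> 1 -> finite_set [set x : G | g * x * g * x = b].
    move=> /sq /(finite_image (fun y => g^-1 * y)).
    apply: sub_finite_set => x /= xb.
    by exists (g * x); rewrite /= ?mulKg // mulgA.
  rewrite /bad !finite_setU; do !split.
  - exact: inj_fin.
  - by apply: inj_fin; exact: mulgI.
  - apply: finite_preimage_fibers => // b /EN[b1 _ _].
    by apply: finite_setIr; exact: sq.
  (* [x * g * x = b] amounts to [(g * x) ^+ 2 = g * b], and [g * b] is not 1 because [E] omits
     [g^-1]. *)
  - apply: finite_preimage_fibers => // b /EN[_ _ bg]; apply: finite_setIr.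
    apply: sub_finite_set (sq' (g * b) _) => [x /= <-|]; first by rewrite !mulgA.
    by move=> /mulg1_eq/esym.
  - apply: finite_preimage_fibers => // b /EN[_ bg _]; apply: finite_setIr.
    apply: sub_finite_set (sq (g^-1 * b) _) => [x /= <-|].
      by rewrite -mulgA mulKg.
    by move=> /mulg1_eq; rewrite invgK => /esym.
  - apply: finite_preimage_fibers => // b /EN[b1 _ _].
    by apply: finite_setIr; exact: sq'.
  - by apply: finite_preimage_fibers => // b /EN[_ bg _]; exact: Pconj.
have [x [Px]] := infinite_setN0 (infinite_setD Pinf badfin).
have NP (Q : Prop) : ~ (P x /\ Q) -> ~ Q by move=> NPQ Qx; exact: NPQ.
rewrite /bad => /not_orP[/not_orP[/not_orP[/not_orP[/not_orP[/not_orP[]]]]]].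
move=> /NP/= Nx /NP/= Ngx /NP/= Nxx /NP/= Nxgx /NP/= Ngxx /NP/= Ngxgx /NP/= Nconj.
exists x; split=> [u [[[]|]|] /= -> Bu|].
- by apply: Nx; left.
- by apply: Ngx; left.
- by apply: Nx; rewrite -[x]invgK; apply: CV; left.
- by apply: Ngx; rewrite -[g * x]invgK; apply: CV; left.
have NV w : ~ E w -> ~ E w^-1 by move=> Nw /EV.
have N1 : ~ E 1 by move=> /EN[].
have Ng : ~ E g by move=> /EN[].
have NgV := NV _ Ng; have NxxV := NV _ Nxx; have NxgxV := NV _ Nxgx.
have NgxxV := NV _ Ngxx; have NgxgxV := NV _ Ngxgx.
have NconjV := NV _ Nconj; clear NV.
rewrite !conjgE ?invgM ?invgK ?mulgA in NxxV NxgxV NgxxV NgxgxV Nconj NconjV.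
move=> u v Su Sv Buv; apply: contrapT => Kuv.
suff : ~ E (u * v^-1) by apply; split=> //; left.
case: Su => [[[]|]|] /= ->; case: Sv => [[[]|]|] /= ->;
  rewrite ?invgM ?invgK ?mulgA ?mulgK ?mulgVK ?mulgV ?mulVg ?mul1g //.
Qed.

Lemma pair_closureV (G : groupType) (g x u : G) :
  pair_closure G g x u -> pair_closure G g x u^-1.
Proof.
move=> [[[]|]|] /= ->; rewrite ?invgK;
  [left; right|right|left; left; left|left; left; right] => //.
Qed.

Lemma finite_set_index_bounded (T : eqType) (f : T -> nat) (Y : set T) :
  finite_set Y -> exists K, forall y, Y y -> (f y < K)%N.
Proof.
move=> /finite_seqP[r ->]; exists (\max_(y <- r) f y).+1 => y /= yr.
by rewrite ltnS; exact: leq_bigmax_seq.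
Qed.

(** Decoding [k] to a pair [(t, r)] and forgetting [r] repeats every [t] infinitely often; [t0]
    fills the numbers that encode no pair. *)
Lemma exists_recurrent_schedule (T : countType) (t0 : T) :
  exists task : nat -> T, forall t K, exists2 k, (K <= k)%N & task k = t.
Proof.
exists (fun k => (odflt (t0, 0) (unpickle k)).1) => t K.
pose h (r : nat) := pickle (t, r); have hinj : injective h.
  by move=> r r' /(pcan_inj pickleK)[].
have hfin : finite_set (h @^-1` `I_K).
  by apply: finite_preimage (finite_II K) => r r' _ _; exact: hinj.
have [r [_ /= /negP rK]] := infinite_setN0 (infinite_setD infinite_nat hfin).
by exists (h r); [rewrite leqNgt | rewrite /h pickleK].
Qed.

(* A stage of the construction is encoded as the finite set D of the pairs (j, u)
   such that u <> 1 has been put in X_j. *)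
Definition color (G : groupType) (D : set (nat * G)) (j : nat) : set G :=
  [set u | u = 1 \/ D (j, u)].

(** The construction only has to know which X_(s i) is to be Delta(X_i), so all X_j are built at
    once for an arbitrary [s]; the cyclic case is [s i = i.+1 %% n]. *)
Lemma exists_prescribed_derivation (G : groupType) (f : G -> nat)
    (s : nat -> nat) :
    injective f -> infinite_set [set: G] ->
    (forall g : G, g <> 1 -> finite_set [set x : G | x ^+ 2 = g]) ->
  exists X : nat -> set G,
    (forall i, combinatorial_derivation (X i) = X (s i)) /\
    (forall i j, i <> j -> X i `&` X j = [set 1]).
Proof.
move=> finj Ginf sqrt_fin.
have /choice[pick pickP] (p : G * set G) : exists x, finite_set p.2 ->
    (forall u, pair_closure G p.1 x u -> ~ p.2 u) /\
    (forall u v, pair_closure G p.1 x u -> pair_closure G p.1 x v ->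
       p.2 (u * v^-1) -> [set 1; p.1; p.1^-1] (u * v^-1)).
  have [pfin|//] := pselect (finite_set p.2); last by exists 1.
  by have [x xP] := exists_generic_pair G p.1 p.2 Ginf sqrt_fin pfin; exists x.
have [task taskP] := exists_recurrent_schedule (nat * nat)%type (0, 0).
pose i k := (task k).1.
pose F k := [set h | (f h < k)%N] `|` [set h | (f h^-1 < k)%N].
have Ffin k : finite_set (F k).
  rewrite finite_setU; split.
    by apply: (finite_preimage _ (finite_II k)) => h h' _ _; exact: finj.
  apply: (finite_preimage (f := fun h => f h^-1) _ (finite_II k)).
  by move=> h h' _ _ /finj/invg_inj.
pose T (D : set (nat * G)) := 1 |` [set p.2 | p in D].
(* Avoiding [T D] keeps distinct X_j disjoint outside 1. Avoiding the products keeps quotients of a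
   new and an old element out of [F k], which is closed under inversion to cover both orders. *)
pose B k D := T D `|` F k `|` [set h * v | h in F k & v in T D].
(* If the scheduled element is not yet in X_(s i), the stage serves 1 instead, which lies in every
   X_j. *)
pose gen k D := xget 1 [set h | f h = (task k).2 /\ color G D (s (i k)) h].
pose new k D := pair_closure G (gen k D) (pick (gen k D, B k D)).
pose step k D := D `|` [set (i k, u) | u in new k D].
pose D k := iteri k step set0.
have DS k : D k.+1 = D k `|` [set (i k, u) | u in new k (D k)] by [].
have newfin k E : finite_set (new k E).
  by rewrite /new /pair_closure !finite_setU; do !split; exact: finite_set1.
have Bfin k : finite_set (B k (D k)).
  have Dfin : finite_set (D k).
    elim: k => [|k IH]; first exact: finite_set0.
    by rewrite DS finite_setU; split=> //; exact: finite_image.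
  have Tfin : finite_set (T (D k)).
    by rewrite finite_setU; split; [exact: finite_set1|exact: finite_image].
  by rewrite 2!finite_setU; do !split=> //; exact: finite_image2.
have new_fresh k u : new k (D k) u -> ~ B k (D k) u.
  by have [+ _] := pickP (gen k (D k), B k (D k)) (Bfin k); apply.
have new_quot k u v : new k (D k) u -> new k (D k) v ->
    B k (D k) (u * v^-1) -> [set 1; gen k (D k); (gen k (D k))^-1] (u * v^-1).
  by have [_] := pickP (gen k (D k), B k (D k)) (Bfin k); apply.
have gen_color k : color G (D k) (s (i k)) (gen k (D k)).
  by rewrite /gen; case: xgetP => [h _ []|_] //; left.
have Dle k l : (k <= l)%N -> D k `<=` D l.
  elim: l => [|l IH]; first by rewrite leqn0 => /eqP->.
  by rewrite leq_eqVlt ltnS => /predU1P[->//|/IH kl] p /kl; left.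
have colorV k j u : color G (D k) j u -> color G (D k) j u^-1.
  case=> [->|Dju]; [by left; rewrite invg1 | right].
  elim: k Dju => [//|k IH]; rewrite DS => -[/IH|[v nv [<- <-]]]; first by left.
  by right; exists v^-1 => //; exact: pair_closureV.
have color_T k j u : color G (D k) j u -> T (D k) u.
  by case=> [->|Dju]; [left | right; exists (j, u)].
have D_inj k a b u : D k (a, u) -> D k (b, u) -> a = b.
  elim: k => [//|k IH]; rewrite DS.
  move=> [Da|[v nv [<- vu]]] [Db|[w nw [<- wu]]] //.
  - exact: IH Da Db.
  - case: (new_fresh _ _ nw); left; left; right; exists (a, u) => //.
  - case: (new_fresh _ _ nv); left; left; right; exists (b, u) => //.
exists (fun j => \bigcup_k color G (D k) j); split; last first.
  move=> a b ab; apply/seteqP; split=> [u [[k _ uk] [l _ ul]]|u ->].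
    case: uk => [//|uk]; case: ul => [//|ul]; case: ab.
    exact: (D_inj (maxn k l) _ _ u (Dle _ _ (leq_maxl _ _) _ uk)
              (Dle _ _ (leq_maxr _ _) _ ul)).
  by split; exists 0 => //; left.
move=> j; apply/seteqP; split=> [h hinf|h [K _ hK] /(finite_set_index_bounded _ f)].
  apply: contrapT => hX; apply: hinf.
  (* A representation of h as a quotient of elements of X_j cannot appear at a
     stage after h has been enumerated. *)
  have stable k u v : F k h -> color G (D k.+1) j u -> color G (D k.+1) j v ->
      u = h * v -> color G (D k) j u /\ color G (D k) j v.
    have split_color w : color G (D k.+1) j w ->
        color G (D k) j w \/ i k = j /\ new k (D k) w.
      rewrite /color DS.
      by move=> [->|[Dw|[w' nw [<- <-]]]]; [left; left|left; right|right].
    move=> Fh /split_color[uo|[ij un]] /split_color[vo|[_ vn]] // uhv.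
    - case: (new_fresh _ _ vn); right; exists h^-1.
        by case: Fh => Fh; [right; rewrite /= invgK|left].
      by exists u; [exact: color_T uo | rewrite uhv mulKg].
    - case: (new_fresh _ _ un); right; exists h => //.
      by exists v => //; exact: color_T vo.
    - have huv : h = u * v^-1 by rewrite uhv mulgK.
      case: hX; exists k => //; rewrite -ij.
      have := new_quot _ _ _ un vn; rewrite -huv => /(_ _)[|[->|->]|->].
      + by left; right.
      + by left.
      + exact: gen_color.
      + exact/colorV/gen_color.
  (* As long as [f h < k], [stable] moves the pair from stage [k.+1] back to stage [k], so it is
     already present at stage [(f h).+1], which is finite. *)
  have old k u v : color G (D k) j u -> color G (D k) j v -> u = h * v ->
      color G (D (f h).+1) j u /\ color G (D (f h).+1) j v.
    elim: k => [|k IH] uk vk uhv.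
      by case: uk => // ->; case: vk => // ->; split; left.
    have [fk|kf] := ltnP (f h) k.
      have [//|uk' vk'] := stable k u v _ uk vk uhv; first by left.
      exact: IH.
    have up w : color G (D k.+1) j w -> color G (D (f h).+1) j w.
      by case=> [->|Dw]; [left | right; exact: (Dle k.+1)].
    by split; exact: up.
  have : finite_set (T (D (f h).+1)).
    by apply: sub_finite_set (Bfin (f h).+1) => u; left; left.
  apply: sub_finite_set => u [[v [k _ vk] hvu] [l _ ul]].
  have up k' w : (k' <= maxn k l)%N -> color G (D k') j w ->
      color G (D (maxn k l)) j w.
    by move=> le; case=> [->|Dw]; [left | right; exact: Dle le _ Dw].
  have [uo _] := old _ _ _ (up _ _ (leq_maxr _ _) ul) (up _ _ (leq_maxl _ _) vk)
    (esym hvu).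
  exact: color_T uo.
move=> [M bM].
(* From stage [K] on, [h] is available to be served. The new [h * x] avoids [F k], so its index is
   at least [k], hence at least [M], against the bound [bM]. *)
have [k Kk taskk] := taskP (j, f h) (maxn K M).
have ik : i k = j by rewrite /i taskk.
have genk : gen k (D k) = h.
  rewrite /gen; case: xgetP => [g _ [+ _]|/(_ h)[]].
    by rewrite taskk => /finj.
  rewrite taskk ik; split=> //; case: hK => [->|hK]; [by left | right].
  by apply: Dle hK; rewrite (leq_trans _ Kk) // leq_maxl.
pose x := pick (h, B k (D k)).
have nx : new k (D k) x by rewrite /new genk; left; left; left.
have nhx : new k (D k) (h * x) by rewrite /new genk; left; left; right.
have inX u : new k (D k) u -> (\bigcup_k color G (D k) j) u.
  by move=> nu; exists k.+1 => //; right; rewrite DS; right; exists u; rewrite ?ik.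
have := new_fresh _ _ nhx; apply; left; right; left.
have /bM hM : (ltranslate h (\bigcup_k color G (D k) j) `&`
    \bigcup_k color G (D k) j) (h * x).
  by split; [exists x => //; exact: inX | exact: inX].
by rewrite /= (leq_trans hM) // (leq_trans _ Kk) // leq_maxr.
Qed.

Theorem theorem5p4 (G : groupType)
    (G_countable : countable [set: G])
    (G_infinite : infinite_set [set: G])
    (sqrt_finite : forall g : G, g <> 1 -> finite_set [set x : G | x ^+ 2 = g])
    (n : nat) (n_gt0 : (0 < n)%N) :
  exists X : nat -> set G,
    [/\ forall i : nat, (i < n - 1)%N ->
          combinatorial_derivation (X i) = X i.+1,
        combinatorial_derivation (X (n - 1)%N) = X 0%N
      & forall i j : nat, (i < j)%N -> (j < n)%N -> X i `&` X j = [set 1]].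
Proof.
have [f finj] := countable_injP _ G_countable.
have [X [dX iX]] := exists_prescribed_derivation G f (fun i => i.+1 %% n)
  (in2TT finj) G_infinite sqrt_finite.
exists X; split=> [i ilt||i j ij _].
- by rewrite dX modn_small // -ltn_predRL -subn1.
- by rewrite dX subn1 prednK // modnn.
- by apply: iX => ijE; rewrite ijE ltnn in ij.
Qed.
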